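(* Let $\Sigma$ be a compact spacelike hypersurface in the Lorentz-Minkowski space $\mathbb{L}^{n+1}$, with (necessarily) non-empty boundary $\partial\Sigma$. If $\Sigma$ is not contained in the convex hull of $\partial\Sigma$, then $\Sigma$ has an elliptic point (with respect to the metric induced by $\mathbb{L}^{n+1}$).
   Context: $\mathbb{L}^{n+1}$ is $\mathbb{R}^{n+1}$ endowed with the metric $\langle\cdot,\cdot\rangle_L=dx_1^2+\dots+dx_n^2-dx_{n+1}^2$, with Levi-Civita connection $\overline\nabla$ (which coincides with the Euclidean one). Hypersurfaces are smooth and connected, of dimension $n$; a hypersurface is spacelike if the metric induced on it by $\langle\cdot,\cdot\rangle_L$ is Riemannian. There are no compact spacelike hypersurfaces without boundary in $\mathbb{L}^{n+1}$. Let $N_L$ be the future-directed (positive last component) unit normal field of $\Sigma$, $\langle N_L,N_L\rangle_L=-1$, and $A_LX=-\overline\nabla_XN_L$ the shape operator, whose eigenvalues $k_1^L,\dots,k_n^L$ are the principal curvatures of $(\Sigma,\langle\cdot,\cdot\rangle_L)$. A point is elliptic if all the principal curvatures at it have the same sign, i.e. they are all strictly positive or all strictly negative. Convex hulls are taken in the affine space $\mathbb{R}^{n+1}$. *)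

(* Defs.v *)
From mathcomp Require Import all_boot all_order all_algebra.
From mathcomp Require Import all_classical all_reals all_analysis.
Import Order.TTheory GRing.Theory Num.Theory.
Import numFieldNormedType.Exports.

Set Implicit Arguments.
Unset Strict Implicit.
Unset Printing Implicit Defensive.

Local Open Scope classical_set_scope.
Local Open Scope ring_scope.

(* Row vectors ['rV[R]_n] stand for R^n; the timelike coordinate of
   ['rV[R]_n.+1] is the last one, of index [ord_max]. *)
Definition lorentz (R : realType) (n : nat) (x y : 'rV[R]_n.+1) : R :=
  \sum_(i < n.+1 | i != ord_max) x 0 i * y 0 i - x 0 ord_max * y 0 ord_max.

Definition convex_hull (R : realType) (n : nat) (A : set 'rV[R]_n) :
    set 'rV[R]_n :=
  smallest (@convex_set R 'rV[R]_n) A.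

Fixpoint Ck_on (R : realType) (V W : normedModType R) (k : nat)
    (U : set V) (f : V -> W) : Prop :=
  match k with
  | 0 => forall x, U x -> {for x, continuous f}
  | k'.+1 => (forall x, U x -> differentiable f x) /\
             (forall v, Ck_on k' U ('D_v f))
  end.

Definition smooth_on (R : realType) (V W : normedModType R)
    (U : set V) (f : V -> W) : Prop :=
  forall k, Ck_on k U f.

(* Conditions on the coordinate of index 0, phrased so that [n] is arbitrary:
   R^0 is its own half-space, and the wall is then empty. *)
Definition half_space (R : realType) (n : nat) : set 'rV[R]_n :=
  [set u | forall i : 'I_n, i = 0%N :> nat -> 0 <= u 0 i].
Arguments half_space : clear implicits.

Definition wall (R : realType) (n : nat) : set 'rV[R]_n :=
  [set u | exists2 i : 'I_n, i = 0%N :> nat & u 0 i = 0].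
Arguments wall : clear implicits.

(* [phi] is a homeomorphism from [U `&` half_space R n] onto an open subset of
   [M], in which [psi \o phi] is an immersion smooth up to the wall, i.e. it is
   the restriction of a map [X] that is smooth on the open set [U] of R^n. *)
Record local_param (R : realType) (n : nat) (M : topologicalType)
    (psi : M -> 'rV[R]_n.+1) (U : set 'rV[R]_n) (phi : 'rV[R]_n -> M)
    (X : 'rV[R]_n -> 'rV[R]_n.+1) : Prop := LocalParam {
  local_param_open : open U ;
  local_param_inj : set_inj (U `&` half_space R n) phi ;
  local_param_continuous : {within U `&` half_space R n, continuous phi} ;
  local_param_open_map : forall W : set 'rV[R]_n, open W ->
    open (phi @` (W `&` (U `&` half_space R n))) ;
  local_param_smooth : smooth_on U X ;
  local_paramE : forall u, (U `&` half_space R n) u -> X u = psi (phi u) ;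
  local_param_immersion : forall u, (U `&` half_space R n) u ->
    row_free ('J X u) }.

(* [u] is the coordinate of the point [p] in a local parametrization. *)
Definition param_at (R : realType) (n : nat) (M : topologicalType)
    (psi : M -> 'rV[R]_n.+1) (p : M) (X : 'rV[R]_n -> 'rV[R]_n.+1)
    (u : 'rV[R]_n) : Prop :=
  exists (U : set 'rV[R]_n) (phi : 'rV[R]_n -> M),
    [/\ local_param psi U phi X, (U `&` half_space R n) u & phi u = p].

(* A connected hypersurface with boundary, immersed in R^(n+1) by [psi]; the
   embedded ones are the inclusions of subspaces of R^(n+1). No smooth
   structure on [M] is postulated: transition maps between two local
   parametrizations are smooth because [psi] is an immersion in both. *)
Record hypersurface (R : realType) (n : nat) (M : topologicalType)
    (psi : M -> 'rV[R]_n.+1) : Prop := Hypersurface {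
  hypersurface_hausdorff : hausdorff_space M ;
  hypersurface_countable : @second_countable M ;
  hypersurface_connected : connected [set: M] ;
  hypersurface_param : forall p : M, exists X u, param_at psi p X u }.

Definition boundary (R : realType) (n : nat) (M : topologicalType)
    (psi : M -> 'rV[R]_n.+1) : set M :=
  [set p | exists X u, param_at psi p X u /\ wall R n u].

Definition spacelike (R : realType) (n : nat) (M : topologicalType)
    (psi : M -> 'rV[R]_n.+1) : Prop :=
  forall p X u, param_at psi p X u ->
  forall w : 'rV[R]_n, w != 0 -> 0 < lorentz ('D_w X u) ('D_w X u).

(* The vector is unique where [X] is a spacelike immersion. *)
Definition unit_normal (R : realType) (n : nat)
    (X : 'rV[R]_n -> 'rV[R]_n.+1) (u : 'rV[R]_n) : 'rV[R]_n.+1 :=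
  xget 0 [set N : 'rV[R]_n.+1 |
    [/\ forall w : 'rV[R]_n, lorentz N ('D_w X u) = 0,
        lorentz N N = -1 & 0 < N 0 ord_max]].

(* The image by the shape operator of the tangent vector ['D_w X u]. On the
   wall it does not depend on the extension [X]: being a spacelike immersion is
   an open condition, so the normal is smooth around [u], and its first
   derivatives at [u] are determined by its values on the half-space. *)
Definition shape_operator (R : realType) (n : nat)
    (X : 'rV[R]_n -> 'rV[R]_n.+1) (u w : 'rV[R]_n) : 'rV[R]_n.+1 :=
  - 'D_w (unit_normal X) u.

Definition principal_curvature (R : realType) (n : nat) (M : topologicalType)
    (psi : M -> 'rV[R]_n.+1) (p : M) (k : R) : Prop :=
  exists X u, param_at psi p X u /\
    exists2 w : 'rV[R]_n, w != 0 & shape_operator X u w = k *: 'D_w X u.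

Definition elliptic (R : realType) (n : nat) (M : topologicalType)
    (psi : M -> 'rV[R]_n.+1) (p : M) : Prop :=
  (forall k, principal_curvature psi p k -> 0 < k) \/
  (forall k, principal_curvature psi p k -> k < 0).

(* Main.v *)
Require Import Defs.
From mathcomp Require Import all_boot all_order all_algebra.
From mathcomp Require Import all_classical all_reals all_analysis.
From mathcomp Require Import ring lra.
Import Order.TTheory GRing.Theory Num.Theory.
Import numFieldNormedType.Exports.
Set Implicit Arguments.
Unset Strict Implicit.
Unset Printing Implicit Defensive.
Local Open Scope classical_set_scope.
Local Open Scope ring_scope.

(** Write [<x, y>_E] for the Euclidean product. A point [q] of the hypersurface
    outside the convex hull of the compact set [psi (boundary)] is strictly
    separated from it by a linear form [<a, _>_E]; as that set is bounded, a
    small [e > 0] keeps the values of [f y = <a, y>_E + e <y, y>_E] on it below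
    [f q] ([exists_quadratic_separation]). So the maximum of [f] over the
    compact hypersurface is reached at some [p] off the boundary.

    At [p] the gradient [eta = a + 2 e psi p] of [f] is Euclidean-orthogonal to
    the tangent hyperplane, and the second derivative test in a chart [X] gives
    [<eta, D_w D_w X>_E <= - 2 e <D_w X, D_w X>_E < 0] for every [w != 0].
    Changing the sign of the last coordinate turns [eta] into a
    Lorentz-orthogonal vector, hence into a multiple of the normal [N] whose
    factor has the sign of [- eta_(n+1)]: therefore [<N, D_w D_w X>_L] has the
    sign of [eta_(n+1)]. Differentiating [<N, D_w X>_L = 0] shows that it equals
    [- <D_w N, D_w X>_L], which is [k <D_w X, D_w X>_L] if [w] is a principal
    direction of curvature [k]. As the tangent vector is spacelike, [k] has the
    sign of [eta_(n+1)], which depends on [p] only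
    ([principal_curvature_at_max]).

    Three facts support this argument. The convex hull of a compact set is
    replaced by the combinations of a bounded number of points, which form a
    compact set, and the nearest point of it to [q] separates strictly
    ([strict_separation], through Caratheodory's reduction). The boundary is
    closed, because a point seen inside the half-space by one chart is never
    seen on the wall by another ([param_at_off_wall]); this also ensures that
    every chart at [p] is interior. Finally the unit normal is differentiable,
    because the tangent hyperplane is a graph over the spacelike coordinates and
    Cramer's rule gives its slope ([unit_normalE], [differentiable_frame_normal]). *)

(** * The Euclidean product *)

Section Dot.
Context {R : realType} {d : nat}.
Implicit Types x y z : 'rV[R]_d.

Definition dot x y : R := \sum_(i < d) x 0 i * y 0 i.

Lemma dotC x y : dot x y = dot y x.
Proof. by apply: eq_bigr => i _; rewrite mulrC. Qed.

Lemma dotDl x y z : dot (x + y) z = dot x z + dot y z.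
Proof. by rewrite -big_split; apply: eq_bigr => i _; rewrite mxE mulrDl. Qed.

Lemma dotZl c x y : dot (c *: x) y = c * dot x y.
Proof. by rewrite /dot big_distrr /=; apply: eq_bigr => i _; rewrite mxE mulrA. Qed.

Lemma dotNl x y : dot (- x) y = - dot x y.
Proof. by rewrite -scaleN1r dotZl mulN1r. Qed.

Lemma dotBl x y z : dot (x - y) z = dot x z - dot y z.
Proof. by rewrite dotDl dotNl. Qed.

Lemma dotDr x y z : dot z (x + y) = dot z x + dot z y.
Proof. by rewrite !(dotC z) dotDl. Qed.

Lemma dotBr x y z : dot z (x - y) = dot z x - dot z y.
Proof. by rewrite !(dotC z) dotBl. Qed.

Lemma dot_ge0 x : 0 <= dot x x.
Proof. by apply: sumr_ge0 => i _; rewrite -expr2 sqr_ge0. Qed.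

Lemma dot_gt0 x : x != 0 -> 0 < dot x x.
Proof.
move=> x0; rewrite lt_neqAle dot_ge0 andbT eq_sym psumr_neq0; last first.
  by move=> i _; rewrite -expr2 sqr_ge0.
have [i xi] : exists i, x 0 i != 0.
  apply/existsP; rewrite -negb_forall; apply: contra x0 => /forallP x0.
  by apply/eqP/rowP => i; rewrite mxE; apply/eqP.
by apply/hasP; exists i; rewrite ?mem_index_enum//= -expr2 exprn_even_gt0.
Qed.

Lemma continuous_dotP (T : topologicalType) (f g : T -> 'rV[R]_d) t :
  {for t, continuous f} -> {for t, continuous g} ->
  {for t, continuous (fun s => dot (f s) (g s))}.
Proof.
move=> cf cg; apply: (@cvg_big _ _ _ _ _ add_continuous) => i _.
apply: cvgM.
  exact: (cvg_comp _ _ cf (@coord_continuous _ _ _ 0 i (f t))).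
exact: (cvg_comp _ _ cg (@coord_continuous _ _ _ 0 i (g t))).
Qed.

End Dot.

(** * Convex hulls of compact sets *)

Section Caratheodory.
Context {R : realType} {d : nat}.
Implicit Types (t : nat -> R) (b : nat -> 'rV[R]_d).

(** The [d + 2] rows [(b i, 1)] have width [d + 1], so they are linearly
    dependent. The coefficients have sum zero, so one of them is positive. *)
Lemma affine_dependence b : exists c : 'I_d.+2 -> R,
  [/\ exists i, 0 < c i, \sum_i c i = 0 & \sum_i c i *: b i = 0].
Proof.
pose A : 'M[R]_(d.+2, d + 1) := row_mx (\matrix_(i < d.+2) b i) (const_mx 1).
have [v vA v0] : exists2 v : 'rV[R]_d.+2, v *m A = 0 & v != 0.
  have : ~~ row_free A.
    rewrite -row_leq_rank -ltnNge (leq_ltn_trans (rank_leq_col A))//.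
    by rewrite addn1.
  rewrite -kermx_eq0 => /rowV0Pn[v /sub_kermxP vA v0]; by exists v.
have : row_mx (v *m \matrix_(i < d.+2) b i) (v *m const_mx 1) = 0 :> 'rV_(d + 1).
  by rewrite -mul_mx_row.
rewrite -row_mx0 => /eq_row_mx[vb v1].
have sv : \sum_i v 0 i = 0.
  move/rowP: v1 => /(_ 0); rewrite !mxE => v1; rewrite -[RHS]v1.
  by apply: eq_bigr => i _; rewrite mxE mulr1.
exists (fun i => v 0 i); split => //; last first.
  rewrite -[RHS]vb mulmx_sum_row; apply: eq_bigr => i _.
  by rewrite rowK.
apply: contrapT => vneg.
have vle i : v 0 i <= 0.
  by rewrite leNgt; apply/negP => vi; apply: vneg; exists i.
move/negP: v0; apply; apply/eqP/rowP => i; rewrite mxE.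
have := sv; rewrite (bigD1 i)//= => /eqP.
rewrite addr_eq0 => /eqP vi; apply/eqP; rewrite eq_le vle vi oppr_ge0.
by apply: sumr_le0.
Qed.

(** Convex combinations of exactly [m] points. Fixing the number of points makes
    this set compact; families indexed by [nat] make it easy to append a point. *)
Definition combinations (B : set 'rV[R]_d) m : set 'rV[R]_d :=
  [set x | exists t b, [/\ forall i, (i < m)%N -> 0 <= t i /\ B (b i),
     \sum_(i < m) t i = 1 & x = \sum_(i < m) t i *: b i]].

(** Subtracting a multiple of an affine dependence changes neither the point nor
    the total weight; the multiple is chosen so that a first weight vanishes. *)
Lemma caratheodory_step (B : set 'rV[R]_d) :
  combinations B d.+2 `<=` combinations B d.+1.
Proof.
move=> _ [t [b [tB t1 ->]]].
have [c [[i0 ci0] c0 cb]] := affine_dependence b.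
have [i ci imin] : exists2 i, 0 < c i & forall j, 0 < c j -> t i / c i <= t j / c j.
  case: (@arg_minP _ _ _ i0 (fun i => 0 < c i) (fun i : 'I_d.+2 => t i / c i) ci0).
  by move=> i ci imin; exists i.
(* the smallest ratio is where the first weight vanishes *)
pose r := t i / c i.
have r0 : 0 <= r by rewrite divr_ge0 ?(ltW ci)//; case: (tB i).
pose t' (j : nat) := t (bump i j) - r * c (inord (bump i j)).
have t'E (j : 'I_d.+1) : t' j = t (lift i j) - r * c (lift i j).
  by rewrite /t' -[bump i j]/(nat_of_ord (lift i j)) inord_val.
have sumE (V : lmodType R) (f : 'I_d.+2 -> V) :
    \sum_j c j *: f j = 0 ->
    \sum_(j < d.+1) t' j *: f (lift i j) = \sum_(j < d.+2) t j *: f j.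
  move=> cf; rewrite [RHS](bigD1_ord i)//=.
  have -> : t i = r * c i by rewrite /r divfK// gt_eqF.
  move: cf; rewrite (bigD1_ord i)//= => /eqP; rewrite addr_eq0 => /eqP cf.
  rewrite -scalerA cf scalerN scaler_sumr -sumrN -big_split/=.
  apply: eq_bigr => j _; rewrite t'E scalerBl -scalerA addrC; congr (_ + _).
exists t', (b \o bump i); split.
- move=> j jd; have := t'E (Ordinal jd); rewrite /= => ->.
  have [tj Bj] := tB (lift i (Ordinal jd)) (ltn_ord _); split=> //.
  rewrite subr_ge0; have [cj|cj] := ltP 0 (c (lift i (Ordinal jd))).
    by rewrite -ler_pdivlMr//; exact: (imin (lift i (Ordinal jd)) cj).
  by rewrite (le_trans _ tj)// mulr_ge0_le0.
- have := sumE R^o (fun=> 1); move=> s1.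
  rewrite -t1; transitivity (\sum_(j < d.+1) t' j *: (1 : R^o)).
    by apply: eq_bigr => j _; rewrite [RHS]mulr1.
  rewrite s1; first by apply: eq_bigr => j _; exact: mulr1.
  by rewrite -[RHS]c0; apply: eq_bigr => j _; exact: mulr1.
- by rewrite -(sumE _ (fun j : 'I_d.+2 => b j)).
Qed.

(** Partial sums, divided by their weight, stay in the convex set. The weight may
    be zero at first, and then the partial sum is zero as well. *)
Lemma combinations_sub_convex (A B : set 'rV[R]_d) m :
  convex_set A -> B `<=` A -> combinations B m `<=` A.
Proof.
move=> cA BA _ [t [b [tB t1 ->]]].
suff H : forall k, (k <= m)%N -> 0 < \sum_(i < k) t i ->
    A ((\sum_(i < k) t i)^-1 *: \sum_(i < k) t i *: b i).
  by have := H m (leqnn m); rewrite t1 invr1 scale1r; apply; exact: ltr01.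
elim=> [_|k IH km]; first by rewrite big_ord0 ltxx.
have t0 i : (i < k)%N -> 0 <= t i.
  by move=> ik; case: (tB i) => //; exact: ltn_trans km.
have [tk Bk] := tB k km.
rewrite !big_ord_recr/=; set s := \sum_(i < k) t i; set x := \sum_(i < k) _.
have s0 : 0 <= s by apply: sumr_ge0 => i _; exact: t0.
have [sE|sN0] := eqVneq s 0.
  have -> : x = 0.
    apply: big1 => i _; move/psumr_eq0P : sE => ->//; first by rewrite scale0r.
    by move=> j _; exact: t0.
  by rewrite sE !add0r => tk0; rewrite scalerA mulVf ?gt_eqF// scale1r; exact: BA.
move=> st; have sgt : 0 < s by rewrite lt_neqAle eq_sym sN0.
have p0 : 0 <= s / (s + t k) by rewrite divr_ge0 ?addr_ge0.
have p1 : s / (s + t k) <= 1 by rewrite ler_pdivrMr// mul1r lerDl.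
have := cA (s^-1 *: x) (b k) (Itv01 p0 p1) (mem_set (IH (ltnW km) sgt))
  (mem_set (BA _ Bk)).
rewrite inE; congr (A _).
rewrite -[LHS]/(s / (s + t k) *: (s^-1 *: x) + (1 - s / (s + t k)) *: b k).
rewrite scalerDr !scalerA; congr (_ *: _ + _ *: _); first by field; rewrite !gt_eqF.
by field; rewrite gt_eqF.
Qed.

(** Once the total weight is free, appending a point is a continuous operation on
    a product of compact sets. The weight is recorded in the first component, so
    that convex combinations are a closed slice of this set. *)
Lemma compact_cone (B : set 'rV[R]_d) m : compact B ->
  compact [set p : R * 'rV[R]_d | exists t b,
    (forall i, (i < m)%N -> [/\ 0 <= t i, t i <= 1 & B (b i)]) /\
    p = (\sum_(i < m) t i, \sum_(i < m) t i *: b i)].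
Proof.
move=> cB; elim: m => [|m IH].
  rewrite (_ : mkset _ = [set (0, 0)]); first exact: compact_set1.
  apply/seteqP; split => [_ [t [b [_ ->]]]|_ ->] /=; first by rewrite !big_ord0.
  by exists (fun=> 0), (fun=> 0); split => //; rewrite !big_ord0.
pose g (p : (R * 'rV[R]_d) * (R * 'rV[R]_d)) :=
  (p.1.1 + p.2.1, p.1.2 + p.2.1 *: p.2.2).
have cg : continuous g.
  have cf (U V : topologicalType) : continuous (@fst U V) by move=> p; exact: cvg_fst.
  have cs (U V : topologicalType) : continuous (@snd U V) by move=> p; exact: cvg_snd.
  move=> p; have c11 : p.1.1 @[p --> p] --> p.1.1.
    exact: (continuous_comp (@cf _ _ p) (@cf _ _ _)).
  have c12 : p.1.2 @[p --> p] --> p.1.2.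
    exact: (continuous_comp (@cf _ _ p) (@cs _ _ _)).
  have c21 : p.2.1 @[p --> p] --> p.2.1.
    exact: (continuous_comp (@cs _ _ p) (@cf _ _ _)).
  have c22 : p.2.2 @[p --> p] --> p.2.2.
    exact: (continuous_comp (@cs _ _ p) (@cs _ _ _)).
  exact: (cvg_pair (cvgD c11 c21) (cvgD c12 (cvgZ c21 c22))).
have := continuous_compact (continuous_subspaceT cg)
  (compact_setX IH (compact_setX (@segment_compact R 0 1) cB)).
congr compact; apply/seteqP; split=> p /=.
  move=> [[[_ _] [r b']] /= [[t [b [tB [-> ->]]]]]]; rewrite in_itv/= => -[].
  move=> /andP[r0 r1] Bb' <-.
  exists (fun i => if i == m then r else t i), (fun i => if i == m then b' else b i).
  split=> [i|].
    rewrite ltnS leq_eqVlt; case: eqVneq => [//|_ /= im]; exact: tB.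
  rewrite /g /= !big_ord_recr/= eqxx; congr (_ + _, _ + _);
    by apply: eq_bigr => i _; rewrite ltn_eqF.
move=> [t [b [tB ->]]].
exists ((\sum_(i < m) t i, \sum_(i < m) t i *: b i), (t m, b m)); last first.
  by rewrite /g/= !big_ord_recr.
have [t0 t1 Bm] := tB m (ltnSn m); split=> /=; last by rewrite in_itv/= t0 t1.
by exists t, b; split=> // i im; apply: tB; exact: ltnW.
Qed.

Lemma compact_combinations (B : set 'rV[R]_d) m :
  compact B -> compact (combinations B m).
Proof.
move=> /(@compact_cone _ m) cC.
have cl : closed [set p : R * 'rV[R]_d | p.1 = 1].
  apply: (@preimage_closed _ _ fst [set x : R | x = 1]).
    by move=> p _; exact: cvg_fst.
  exact: closed_eq.
have cs : continuous (@snd R 'rV[R]_d) by move=> p; exact: cvg_snd.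
have := continuous_compact (continuous_subspaceT cs) (compact_closedI cC cl).
congr compact; apply/seteqP; split=> x /=.
  move=> [_ [[t [b [tB ->]]] /= t1] <-]; exists t, b; split=> // i im.
  by case: (tB i im).
move=> [t [b [tB t1 ->]]]; exists (1, \sum_(i < m) t i *: b i) => //; split=> //=.
exists t, b; split; last by rewrite t1.
move=> i im; have [ti Bi] := tB i im; split=> //.
rewrite -t1 (bigD1 (Ordinal im))//= lerDl sumr_ge0// => j _.
by case: (tB j (ltn_ord j)).
Qed.

End Caratheodory.

(** The separating direction joins [q] to its nearest point [x0] among the
    combinations of [d + 1] points of [B]. The segment from [x0] to a point of [B]
    only needs one more point, so it remains among them by Caratheodory's step,
    and the minimality of the distance can be tested along it. *)
Lemma strict_separation (R : realType) d (B : set 'rV[R]_d) (q : 'rV[R]_d) :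
  compact B -> B !=set0 -> ~ convex_hull B q ->
  exists a, forall b, B b -> dot a b < dot a q.
Proof.
move=> cB [b0 Bb0] qB; pose K := combinations B d.+1.
have KB x : K x -> convex_hull B x.
  by move=> Kx A [cA BA]; exact: (combinations_sub_convex cA BA Kx).
have Kb0 : K b0.
  exists (fun i => (i == 0)%:R), (fun=> b0); split => [i _| |].
  - by rewrite ler0n.
  - by rewrite big_ord_recl/= big1 ?addr0.
  - by rewrite big_ord_recl/= big1 ?addr0 ?scale1r// => i _; rewrite scale0r.
pose g (x : 'rV[R]_d) : R := dot (x - q) (x - q).
have cg : {within K, continuous g}.
  apply: continuous_subspaceT => x.
  have cq : {for x, continuous (fun y : 'rV[R]_d => y - q)}.
    exact: (cvgB cvg_id (cvg_cst q)).
  exact: (continuous_dotP cq cq).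
have cK : compact K by exact: compact_combinations.
have [x0] := compact_EVT_min (ex_intro _ b0 Kb0) cK cg.
rewrite inE => Kx0 x0min; exists (q - x0) => b Bb.
have qx0 : q - x0 != 0.
  by apply/eqP => /subr0_eq qx0; apply: qB; rewrite qx0; exact: KB.
suff : dot (q - x0) (b - x0) <= 0.
  have := dot_gt0 qx0; rewrite !dotBr; lra.
have Kseg t : 0 <= t -> t <= 1 -> K (x0 + t *: (b - x0)).
  move=> t0 t1; apply: caratheodory_step.
  have [r [c [rB r1 ->]]] := Kx0.
  exists (fun i => if i == d.+1 then t else (1 - t) * r i),
    (fun i => if i == d.+1 then b else c i); split.
  - move=> i; rewrite ltnS leq_eqVlt; case: eqVneq => [//|_ /= /rB[ri Bi]].
    by rewrite mulr_ge0// subr_ge0.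
  - rewrite big_ord_recr/= eqxx.
    under eq_bigr do rewrite ltn_eqF//.
    by rewrite -mulr_sumr r1 mulr1 subrK.
  - rewrite [RHS]big_ord_recr/= eqxx scalerBr addrCA addrC; congr (_ + _).
    under [RHS]eq_bigr do rewrite ltn_eqF// -scalerA.
    by rewrite -scaler_sumr scalerBl scale1r.
rewrite leNgt; apply/negP => h0.
pose h := dot (q - x0) (b - x0); pose k := dot (b - x0) (b - x0).
have k0 : 0 <= k by exact: dot_ge0.
(* along the segment the squared distance to q changes by t * (t * k - 2 * h) *)
have [t [t0 t1 ht]] : exists t, [/\ 0 < t, t <= 1 & t * k < 2 * h].
  exists (h / (h + k)); have hk : 0 < h + k by rewrite ltr_wpDr.
  rewrite divr_gt0// ler_pdivrMr// mul1r lerDl k0; split=> //.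
  rewrite mulrAC ltr_pdivrMr//; rewrite -/h in h0.
  by have := mulr_gt0 h0 h0; have := mulr_ge0 (ltW h0) k0; lra.
have := x0min _ (mem_set (Kseg t (ltW t0) t1)).
move: ht; rewrite /g /h /k; set y := q - x0; set e := b - x0 => ht.
have -> : x0 + t *: e - q = t *: e - y by rewrite /y opprB addrAC addrC.
have -> : x0 - q = - y by rewrite /y opprB.
rewrite !dotDl !dotDr !dotNl !dotZl !(dotC _ (- y)) !dotNl !(dotC _ (_ *: _)).
rewrite !dotZl (dotC e y) => xmin.
have : t * (t * dot e e) < t * (2 * dot y e) by rewrite ltr_pM2l.
lra.
Qed.

(** On the compact set [B] the linear form keeps away from its value at [q] and
    the squared norm is bounded, so a small multiple of the latter is harmless. *)
Lemma exists_quadratic_separation (R : realType) d (B : set 'rV[R]_d) q :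
  compact B -> B !=set0 -> ~ convex_hull B q ->
  exists a, exists2 e : R, 0 < e &
    forall b, B b -> dot a b + e * dot b b < dot a q + e * dot q q.
Proof.
move=> cB B0 /(strict_separation cB B0)[a aB].
have cid (x : 'rV[R]_d) : {for x, continuous (fun y : 'rV[R]_d => y)} := cvg_id.
have cst_a (x : 'rV[R]_d) : {for x, continuous (fun _ : 'rV[R]_d => a)}.
  exact: cst_continuous.
have ca : {within B, continuous (fun b : 'rV[R]_d => dot a b)}.
  by apply: continuous_subspaceT => x; exact: (continuous_dotP (cst_a x) (cid x)).
have cn : {within B, continuous (fun b : 'rV[R]_d => dot b b)}.
  by apply: continuous_subspaceT => x; exact: (continuous_dotP (cid x) (cid x)).
have [b1 /[!inE] Bb1 b1max] := compact_EVT_max B0 cB ca.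
have [b2 /[!inE] Bb2 b2max] := compact_EVT_max B0 cB cn.
have gap : 0 < dot a q - dot a b1 by rewrite subr_gt0 aB.
have size_gt0 : 0 < dot b2 b2 + 1 by rewrite ltr_wpDl// dot_ge0.
exists a, ((dot a q - dot a b1) / (dot b2 b2 + 1)); first exact: divr_gt0.
move=> b Bb; set e := _ / _.
have e0 : 0 < e by exact: divr_gt0.
have eE : e * (dot b2 b2 + 1) = dot a q - dot a b1 by rewrite divfK// gt_eqF.
have h1 := b1max b (mem_set Bb).
have h2 : e * dot b b <= e * dot b2 b2.
  by apply: ler_wpM2l; [exact: ltW|exact: b2max (mem_set Bb)].
have h3 : 0 <= e * dot q q by rewrite mulr_ge0 ?dot_ge0// ltW.
move: h1 h2 h3 eE; move: (dot a b) (dot a b1) (dot a q) (dot b b) (dot q q).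
clearbody e; move: (dot b2 b2) => r1 r2 r3 r4 r5 r6 h1 h2 h3 h4; lra.
Qed.

(** * The boundary is closed *)

Lemma near_interior (R : realType) n (u : 'rV[R]_n) :
  half_space R n u -> ~ wall R n u ->
  \forall x \near u, half_space R n x /\ ~ wall R n x.
Proof.
case: n u => [|n] u hu wu.
  by apply: (filterS _ (@filterT _ _ (nbhs_filter u))) => x; split=> [[]//|[[]]].
have u0 : 0 < u 0 0.
  rewrite lt_neqAle hu// andbT eq_sym; apply/eqP => u0; apply: wu.
  by exists 0.
have : \forall x \near u, 0 < (x : 'rV[R]_n.+1) 0 0.
  have op : nbhs (u 0 0) [set r : R | 0 < r].
    by apply: open_nbhs_nbhs; split => //; exact: open_gt.
  exact: (@coord_continuous _ 1 n.+1 0 0 u _ op).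
apply: filterS => x x0; split=> [i i0|[i i0]].
  by rewrite (_ : i = 0) ?ltW//; exact: val_inj.
by rewrite (_ : i = 0); [apply/eqP; rewrite gt_eqF|exact: val_inj].
Qed.

Lemma cvg_line (R : realType) (V : normedModType R) (u w : V) :
  (t *: w + u : V) @[t --> (0 : R)] --> u.
Proof.
have : (t *: w + u : V) @[t --> (0 : R)] --> 0 *: w + u.
  by apply: cvgD; [apply: cvgZr_tmp; exact: cvg_id|exact: cvg_cst].
by rewrite scale0r add0r.
Qed.

Section Linear.
Context {R : realType}.

Lemma ler_mx_norm m n (x : 'M[R]_(m, n)) i j : `|x i j| <= `|x|.
Proof.
rewrite [leRHS]/Num.Def.normr/= mx_normrE.
exact: (le_bigmax _ (fun ij => `|x ij.1 ij.2|) (i, j)).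
Qed.

Lemma mulmx_lipschitz m n (A : 'M[R]_(m, n)) :
  exists2 k, 0 < k & forall x : 'rV[R]_m, `|x *m A| <= k * `|x|.
Proof.
exists (1 + \sum_i \sum_j `|A i j|).
  by rewrite ltr_pwDl// sumr_ge0// => i _; apply: sumr_ge0.
move=> x; have k0 : 0 <= \sum_i \sum_j `|A i j|.
  by rewrite sumr_ge0// => i _; apply: sumr_ge0.
rewrite [leLHS]/Num.Def.normr/= mx_normrE bigmax_le//= => [|[i j] _ /=].
  by rewrite mulr_ge0// addr_ge0.
rewrite mxE mulrDl mul1r ler_wpDl//.
rewrite (le_trans (ler_norm_sum _ _ _))// mulr_suml ler_sum// => k _.
rewrite normrM mulrC (bigD1 j)//= mulrDl ler_wpDr//.
  by rewrite mulr_ge0// sumr_ge0.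
by rewrite ler_wpM2l// ler_mx_norm.
Qed.

Lemma differentiable_remainder (V W : normedModType R) (f : V -> W) x e :
  differentiable f x -> 0 < e ->
  exists2 r, 0 < r & forall h, `|h| < r -> `|f (h + x) - (f x + 'd f x h)| <= e * `|h|.
Proof.
move=> /diff_locally/eqaddoP df e0.
have /nbhs_normP[r r0 rP] := df e e0.
by exists r => // h hr; apply: (rP h); rewrite /= sub0r normrN.
Qed.

End Linear.

(** Arithmetic of an estimate in which the error term [e * x] is absorbed by the
    quantity [x] that is being bounded. *)
Lemma le_absorb (R : realFieldType) (A B L t e x : R) :
  x <= L * (t * A + e * (t * B) + e * x) -> e * (2 * L) * x <= x ->
  L * (e * (t * B)) <= L * (t * B) -> x <= 2 * L * (A + B) * t.
Proof. by move=> h1 h2 h3; lra. Qed.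

(** A negative slope [s] outweighs error terms [a0] and [b0] of order [t * e]. *)
Lemma lt0_perturb (R : realFieldType) (t e s K B C a b a0 b0 : R) :
  0 < t * e -> t * (e * (K * (B + C) + 1)) <= t * - s ->
  K * b <= K * (e * (C * t)) -> K * a <= K * (e * (t * B)) ->
  - (K * b) <= b0 -> a0 <= K * a -> 0 <= t * s + a0 - b0 -> False.
Proof. by move=> h1 h2 h3 h4 h5 h6 h7; lra. Qed.

Section TangentCone.
Context {R : realType} {n m : nat}.
Variables (X Y : 'rV[R]_n -> 'rV[R]_m) (u v : 'rV[R]_n).
Hypotheses (dX : differentiable X u) (dY : differentiable Y v).
Hypotheses (Yv : Y v = X u) (fY : row_free ('J Y v)).

(** If points [v'] with [v' - v] in [S] satisfy [Y v' = X (u + t w)] for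
    arbitrarily small [t], then [w *m 'J X u] is a limit of vectors
    [(v' - v) / t *m 'J Y v], so a linear form that is nonnegative on the image of
    [S] is nonnegative on it. Indeed [v' - v] is of order [t], because ['J Y v] is
    injective, and both remainders are then negligible with respect to [t]. *)
Lemma tangent_ge0 (S : set 'rV[R]_n) (w : 'rV[R]_n) (c : 'cV[R]_m) :
  (forall e : R, 0 < e -> exists (t : R) (v' : 'rV[R]_n),
     [/\ 0 < t, t < e, `|v' - v| < e, S (v' - v) & Y v' = X (t *: w + u)]) ->
  (forall h, S h -> 0 <= (h *m 'J Y v *m c) 0 0) ->
  0 <= (w *m 'J X u *m c) 0 0.
Proof.
move=> approx Sc; rewrite leNgt; apply/negP => s0.
set s := (w *m _ *m c) 0 0 in s0.
have [K K0 hK] := mulmx_lipschitz c.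
have [L L0 hL] := mulmx_lipschitz (pinvmx ('J Y v)).
have Yinj (h : 'rV[R]_n) : `|h| <= L * `|h *m 'J Y v|.
  by rewrite -{1}(mulmxKp fY h) hL.
pose C := 2 * L * (`|w *m 'J X u| + `|w|).
have C0 : 0 <= C by rewrite !mulr_ge0// ?addr_ge0// ltW.
pose D := K * (`|w| + C) + 1.
have D0 : 0 < D by rewrite ltr_wpDl// mulr_ge0 ?addr_ge0// ltW.
pose e := Num.min 1 (Num.min (2 * L)^-1 (- s / D)).
have e0 : 0 < e by rewrite !lt_min ltr01 invr_gt0 mulr_gt0// divr_gt0// oppr_gt0.
have e1 : e <= 1 by rewrite ge_min lexx.
have eL : e * (2 * L) <= 1.
  by rewrite -ler_pdivlMr ?mulr_gt0// mul1r !ge_min lexx orbT.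
have eD : e * D <= - s by rewrite -ler_pdivlMr// !ge_min lexx !orbT.
have [rX rX0 hX] := differentiable_remainder dX e0.
have [rY rY0 hY] := differentiable_remainder dY e0.
pose r := Num.min rY (rX / (`|w| + 1)).
have w1 : 0 < `|w| + 1 by rewrite ltr_wpDl.
have r0 : 0 < r by rewrite lt_min rY0 divr_gt0.
have [t [v' [t0 tr vr Sv Yv']]] := approx r r0.
have tw : `|t *: w| = t * `|w| by rewrite normrZ gtr0_norm.
have {hX} : `|X (t *: w + u) - (X u + t *: (w *m 'J X u))| <= e * (t * `|w|).
  rewrite -tw; have := hX (t *: w); rewrite linearZ /= mul_rV_lin1; apply.
  rewrite tw (@le_lt_trans _ _ (t * (`|w| + 1)))// ?ler_wpM2l ?ltW ?ltrDl//.
  by rewrite -ltr_pdivlMr// (lt_le_trans tr)// ge_min lexx orbT.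
set a := _ - _ => ha.
have {hY} : `|Y v' - (Y v + (v' - v) *m 'J Y v)| <= e * `|v' - v|.
  have := hY (v' - v); rewrite subrK mul_rV_lin1; apply.
  by rewrite (lt_le_trans vr)// ge_min lexx.
set b := _ - _ => hb; set h := v' - v in Sv vr hb.
have hE : h *m 'J Y v = t *: (w *m 'J X u) + a - b.
  rewrite /a /b -/h Yv' Yv; move: (X _) (X _) (_ *m _) (_ *: _) => p p' p'' p'''.
  by rewrite !opprD !opprK; apply/rowP => i; rewrite !mxE; ring.
have hh : `|h| <= C * t.
  have hJ : `|h *m 'J Y v| <= t * `|w *m 'J X u| + e * (t * `|w|) + e * `|h|.
    rewrite hE (le_trans (ler_normB _ _))// lerD//.
    by rewrite (le_trans (ler_normD _ _))// lerD// normrZ gtr0_norm.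
  have h1 := le_trans (Yinj h) (ler_wpM2l (ltW L0) hJ).
  have h2 : e * (2 * L) * `|h| <= `|h| by rewrite ler_piMl.
  have h3 : L * (e * (t * `|w|)) <= L * (t * `|w|).
    by rewrite ler_wpM2l ?ler_piMl ?mulr_ge0// ltW.
  exact: le_absorb h1 h2 h3.
have := Sc h Sv; rewrite hE; clearbody a b; rewrite mulmxBl mulmxDl -scalemxAl.
have entryE (p q r' : 'M[R]_1) : (t *: p + q - r') 0 0 = t * p 0 0 + q 0 0 - r' 0 0.
  by rewrite !mxE.
rewrite entryE -/s.
have entry (z : 'rV[R]_m) : `|(z *m c) 0 0| <= K * `|z|.
  by rewrite (le_trans (ler_mx_norm _ _ _)).
have := entry a; have := entry b; rewrite !ler_norml.
have : K * `|a| <= K * (e * (t * `|w|)) by rewrite ler_wpM2l// ltW.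
have : K * `|b| <= K * (e * (C * t)).
  apply: (ler_wpM2l (ltW K0)); apply: (le_trans hb).
  by rewrite (ler_wpM2l (ltW e0)).
have : t * (e * D) <= t * - s by rewrite ler_wpM2l// ltW.
have : 0 < t * e by rewrite mulr_gt0.
move=> te ts Kb Ka /andP[b1 _] /andP[_ a1].
exact: lt0_perturb te ts Kb Ka b1 a1.
Qed.

End TangentCone.

Lemma row_free_submx_sym (F : fieldType) m n (A B : 'M[F]_(m, n)) :
  row_free A -> row_free B -> (A <= B)%MS -> (B <= A)%MS.
Proof.
by move=> /eqP fA /eqP fB AB; rewrite -(mxrank_leqif_sup AB) fA fB.
Qed.

Section Charts.
Context {R : realType} {n : nat} {M : topologicalType}.
Variable psi : M -> 'rV[R]_n.+1.

Lemma local_param_diff U phi X u : local_param psi U phi X -> U u ->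
  differentiable X u.
Proof. by move=> LX; have /(_ 1%N)[+ _] := local_param_smooth LX; exact. Qed.

(** Two charts at the same point: since [phi] is continuous and [chi] is open, the
    points [phi (u + t w)] with small [t] lie in the image by [chi] of a small
    half-ball around [v]. *)
Lemma param_at_approach p X u Y v (w : 'rV[R]_n) (e : R) :
  param_at psi p X u -> param_at psi p Y v -> ~ wall R n u -> 0 < e ->
  exists (t : R) (v' : 'rV[R]_n), [/\ 0 < t, t < e, `|v' - v| < e,
    half_space R n v' & Y v' = X (t *: w + u)].
Proof.
move=> [U [phi [LX [Uu Hu] pu]]] [V [chi [LY Vv pv]]] nw e0.
have nU : \forall x \near u, (U `&` half_space R n) x.
  have oU := local_param_open LX.
  apply: filterS2 (near_interior Hu nw) (open_nbhs_nbhs (conj oU Uu)).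
  by move=> x [].
have cphi : phi x @[x --> u] --> phi u.
  have /(_ u) := local_param_continuous LX.
  have Aou : (U `&` half_space R n)° u := nU.
  by rewrite /continuous_at -(nbhs_subspace_interior Aou).
pose W : set M := chi @` (ball v e `&` (V `&` half_space R n)).
have WP : nbhs (phi u) W.
  apply: open_nbhs_nbhs; split; first exact: (local_param_open_map LY (ball_open v e)).
  by rewrite pu -pv; exists v => //; split=> //; exact: ballxx.
have near0 : \forall t \near (0 : R), W (phi (t *: w + u)) /\
    (U `&` half_space R n) (t *: w + u).
  have nP : nbhs u [set x | W (phi x) /\ (U `&` half_space R n) x].
    have wP : nbhs u [set x | W (phi x)] by exact: (cphi _ WP).
    exact: filterI wP nU.
  exact: (cvg_line w nP).
have [r r0 rP] := (nbhs_normP _ _).1 near0.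
pose t := Num.min r e / 2.
have m0 : 0 < Num.min r e by rewrite lt_min r0.
have t0 : 0 < t by rewrite divr_gt0.
have tm : t < Num.min r e by rewrite ltr_pdivrMr// ltr_pMr// ltr1n.
have [|[v' [vv' Vv'] chiv'] Ut] := rP t.
  by rewrite /= sub0r normrN gtr0_norm// (lt_le_trans tm)// ge_min lexx.
exists t, v'; split=> //.
- by rewrite (lt_le_trans tm)// ge_min lexx orbT.
- by move: vv'; rewrite -ball_normE/= distrC.
- by case: Vv'.
- by rewrite (local_paramE LY)// (local_paramE LX)// chiv'.
Qed.

(** Invariance of the boundary. If [u] is interior, every direction [w] is allowed
    at [u], so by [tangent_ge0] each linear form [c] that is nonnegative on the
    image by ['J Y v] of the half-space is nonnegative on the image of ['J X u],
    hence zero on it. Forms vanishing on the range of ['J Y v] show that both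
    ranges coincide; the form that reads the coordinate of index 0 is then zero on
    the range of ['J Y v], which is absurd. *)
Lemma param_at_off_wall p X u Y v :
  param_at psi p X u -> param_at psi p Y v -> ~ wall R n u -> ~ wall R n v.
Proof.
move=> pX pY nw [i i0 vi].
have [dX dY fX fY XY] : [/\ differentiable X u, differentiable Y v,
    row_free ('J X u), row_free ('J Y v) & Y v = X u].
  have [U [phi [LX Uu pu]]] := pX; have [V [chi [LY Vv pv]]] := pY.
  split; [exact: local_param_diff LX Uu.1|exact: local_param_diff LY Vv.1|
    exact: local_param_immersion LX _ Uu|exact: local_param_immersion LY _ Vv|].
  by rewrite (local_paramE LY)// (local_paramE LX)// pu pv.
have JX0 (c : 'cV[R]_n.+1) :
    (forall h : 'rV[R]_n, 0 <= h 0 i -> 0 <= (h *m 'J Y v *m c) 0 0) ->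
    'J X u *m c = 0.
  move=> hc.
  have ge0 (w : 'rV[R]_n) : 0 <= (w *m 'J X u *m c) 0 0.
    pose S := [set h : 'rV[R]_n | 0 <= h 0 i].
    apply: (@tangent_ge0 _ _ _ X Y u v dX dY XY fY S) => //.
    move=> e e0; have [t [v' [t0 te vv' Hv' Yv']]] := param_at_approach w pX pY nw e0.
    by exists t, v'; split=> //; rewrite /S /= !mxE vi subr0 Hv'.
  apply/colP => j; rewrite [RHS]mxE; apply/eqP.
  have rowj : ('J X u *m c) j 0 = ((delta_mx 0 j : 'rV[R]_n) *m 'J X u *m c) 0 0.
    by rewrite -mulmxA -rowE [RHS]mxE.
  rewrite rowj eq_le ge0 andbT -oppr_ge0.
  by have := ge0 (- delta_mx 0 j); rewrite !mulNmx mxE.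
(* the columns of the cokernel are the forms vanishing on the range of 'J Y v *)
have XsubY : ('J X u <= 'J Y v)%MS.
  rewrite submxE; apply/eqP/matrixP => k j.
  have -> : ('J X u *m cokermx ('J Y v)) k j
      = ('J X u *m col j (cokermx ('J Y v))) k 0.
    by rewrite !mxE; apply: eq_bigr => l _; rewrite !mxE.
  rewrite JX0 ?mxE// => h _.
  by rewrite -mulmxA colE (mulmxA ('J Y v)) mulmx_coker mul0mx mulmx0 mxE.
have YsubX := row_free_submx_sym fX fY XsubY.
have [D JYE] := submxP YsubX.
(* the linear form that reads the coordinate i on the range of 'J Y v *)
pose c : 'cV[R]_n.+1 := pinvmx ('J Y v) *m delta_mx i 0.
have YcE : 'J Y v *m c = delta_mx i 0 by rewrite mulmxA mulmxVp// mul1mx.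
have : 'J X u *m c = 0.
  by apply: JX0 => h hi; rewrite -mulmxA YcE -colE mxE.
move=> Xc0; move: YcE; rewrite JYE -mulmxA Xc0 mulmx0 => /colP/(_ i).
by rewrite !mxE !eqxx => /eqP; rewrite eq_sym oner_eq0.
Qed.

Lemma closed_boundary : hypersurface psi -> closed (boundary psi).
Proof.
move=> hpsi; rewrite -openC openE => p pB.
have [X [u pX]] := hypersurface_param hpsi p.
have nw : ~ wall R n u by move=> uw; apply: pB; exists X, u.
have [U [phi [LX [Uu Hu] pu]]] := pX.
have [W [oW Wu] WP] : exists2 W, open_nbhs u W &
    W `<=` [set x | half_space R n x /\ ~ wall R n x].
  have : nbhs u [set x | half_space R n x /\ ~ wall R n x] := near_interior Hu nw.
  by rewrite nbhsE => -[W]; exists W.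
apply: (@filterS _ _ _ (phi @` (W `&` (U `&` half_space R n)))); last first.
  apply: open_nbhs_nbhs; split; first exact: (local_param_open_map LX oW).
  by exists u.
move=> _ [x [Wx UHx] <-] [Y [v [pY wv]]].
have pXx : param_at psi (phi x) X x by exists U, phi.
by apply: (param_at_off_wall pXx pY) => //; case: (WP x Wx).
Qed.

Lemma continuous_hypersurface : hypersurface psi -> continuous psi.
Proof.
move=> hpsi p; have [X [u [U [phi [LX [Uu Hu] <-]]]]] := hypersurface_param hpsi p.
move=> A; rewrite -(local_paramE LX)// => XA.
have := differentiable_continuous (local_param_diff LX Uu) XA.
rewrite /= nbhsE => -[W [oW Wu] WA].
apply: (@filterS _ _ _ (phi @` (W `&` (U `&` half_space R n)))).
  move=> _ [x [Wx UHx] <-]; rewrite /= -(local_paramE LX)//; exact: WA.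
apply: open_nbhs_nbhs; split; first exact: (local_param_open_map LX oW).
by exists u.
Qed.

End Charts.

(** * The normal of a spacelike frame *)

Section LorentzForm.
Context {R : realType} {n : nat}.
Implicit Types x y z : 'rV[R]_n.+1.

Lemma lorentzE x y : lorentz x y =
  dot (col' ord_max x) (col' ord_max y) - x 0 ord_max * y 0 ord_max.
Proof.
rewrite /lorentz big_mkcond (bigD1_ord ord_max)//= eqxx add0r; congr (_ - _).
by apply: eq_bigr => k _; rewrite eq_sym neq_lift !mxE.
Qed.

Lemma lorentz_sumE x y :
  lorentz x y = \sum_j (-1) ^+ (j == ord_max) * (x 0 j * y 0 j).
Proof.
rewrite lorentzE [RHS](bigD1_ord ord_max)//= eqxx expr1 mulN1r addrC.
congr (_ + _); apply: eq_bigr => k _.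
by rewrite eq_sym (negbTE (neq_lift _ _)) expr0 mul1r !mxE.
Qed.

(** Euclidean orthogonality becomes Lorentz orthogonality after a change of sign
    of the time coordinate. *)
Lemma lorentz_flip x y :
  lorentz (\row_j ((-1) ^+ (j == ord_max) * x 0 j)) y = dot x y.
Proof.
rewrite lorentz_sumE; apply: eq_bigr => j _.
by rewrite mxE; case: (j == _); rewrite ?expr0 ?expr1; ring.
Qed.

Lemma lorentzC x y : lorentz x y = lorentz y x.
Proof. by rewrite !lorentzE dotC [X in _ - X]mulrC. Qed.

Lemma lorentzZl c x y : lorentz (c *: x) y = c * lorentz x y.
Proof. by rewrite !lorentzE linearZ /= dotZl mxE mulrBr mulrA. Qed.

Lemma lorentzNl x y : lorentz (- x) y = - lorentz x y.
Proof. by rewrite -scaleN1r lorentzZl mulN1r. Qed.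

Lemma lorentzZr c x y : lorentz x (c *: y) = c * lorentz x y.
Proof. by rewrite !(lorentzC x) lorentzZl. Qed.

End LorentzForm.

Lemma dotE (R : realType) d (x y : 'rV[R]_d) : dot x y = (x *m y^T) 0 0.
Proof. by rewrite mxE; apply: eq_bigr => i _; rewrite mxE. Qed.

Section NormalOfFrame.
Context {R : realType} {n : nat}.
Variable J : 'M[R]_(n, n.+1).

(** The rows of [J] span a hyperplane that is the graph of a linear form over the
    first [n] coordinates; this is the gradient of that form, by Cramer's rule.
    The formula is a rational function of the entries, which makes its
    differentiability plain. *)
Definition normal_slope : 'rV[R]_n :=
  (\det (col' ord_max J))^-1 *: (\adj (col' ord_max J) *m col ord_max J)^T.

Definition normal_direction : 'rV[R]_n.+1 :=
  \row_j oapp (fun k => normal_slope 0 k) 1 (unlift ord_max j).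

Definition frame_normal : 'rV[R]_n.+1 :=
  (Num.sqrt (- lorentz normal_direction normal_direction))^-1 *: normal_direction.

Lemma normal_direction_space : col' ord_max normal_direction = normal_slope.
Proof. by apply/rowP => k; rewrite mxE mxE liftK. Qed.

Lemma normal_direction_time : normal_direction 0 ord_max = 1.
Proof. by rewrite mxE unlift_none. Qed.

Hypothesis spaceJ : forall w : 'rV[R]_n, w != 0 -> 0 < lorentz (w *m J) (w *m J).

Let space_frame (w : 'rV[R]_n) : col' ord_max (w *m J) = w *m col' ord_max J.
Proof. by apply/rowP => k; rewrite !mxE; apply: eq_bigr => i _; rewrite mxE. Qed.

Let time_frame (w : 'rV[R]_n) : (w *m J) 0 ord_max = (w *m col ord_max J) 0 0.
Proof. by rewrite !mxE; apply: eq_bigr => i _; rewrite mxE. Qed.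

Lemma space_frame_unit : col' ord_max J \in unitmx.
Proof.
rewrite -row_free_unit -kermx_eq0; apply: contraT => /rowV0Pn[w /sub_kermxP wJ w0].
have := spaceJ w0; rewrite lorentzE space_frame wJ /dot big1 => [|i _].
  by rewrite sub0r oppr_gt0 -expr2 ltNge sqr_ge0.
by rewrite mxE mul0r.
Qed.

Lemma normal_slopeE : normal_slope = (invmx (col' ord_max J) *m col ord_max J)^T.
Proof.
by rewrite /normal_slope /invmx space_frame_unit -scalemxAl linearZ.
Qed.

Lemma normal_direction_orthogonal w : lorentz normal_direction (w *m J) = 0.
Proof.
rewrite lorentzE normal_direction_space normal_direction_time mul1r time_frame.
rewrite space_frame dotC dotE normal_slopeE trmxK -mulmxA mulKVmx ?subrr//.
exact: space_frame_unit.
Qed.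

(** With [s] the slope, the tangent vector above [s] is [(s, |s|^2)]; it is
    spacelike, so [|s| < 1]. *)
Lemma normal_direction_timelike : lorentz normal_direction normal_direction < 0.
Proof.
pose w := normal_slope *m invmx (col' ord_max J).
have sw : col' ord_max (w *m J) = normal_slope.
  by rewrite space_frame mulmxKV// space_frame_unit.
have := normal_direction_orthogonal w.
rewrite !lorentzE sw normal_direction_space normal_direction_time !mul1r.
set s := dot _ _ => /eqP; rewrite subr_eq0 => /eqP sE.
have [slope0|slopeN0] := eqVneq normal_slope 0.
  by rewrite /s slope0 /dot big1 ?sub0r ?oppr_lt0// => i _; rewrite mxE mul0r.
have w0 : w != 0.
  apply: contra slopeN0 => /eqP w0; rewrite -sw w0 mul0mx.
  by apply/eqP/rowP => i; rewrite !mxE.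
have := spaceJ w0; rewrite lorentzE sw -sE -/s.
have := dot_gt0 slopeN0; rewrite -/s; nra.
Qed.

(** The difference [z] of the two slopes is orthogonal to the space components of
    all tangent vectors, which fill the whole of [R^n]; so [z] is orthogonal to
    itself. *)
Lemma orthogonal_frame_colinear N : (forall w, lorentz N (w *m J) = 0) ->
  N = N 0 ord_max *: normal_direction.
Proof.
move=> NJ; pose z := col' ord_max N - N 0 ord_max *: normal_slope.
have z0 : z = 0.
  apply/eqP; apply: contraT => /dot_gt0.
  have := NJ (z *m invmx (col' ord_max J)).
  have := normal_direction_orthogonal (z *m invmx (col' ord_max J)).
  rewrite !lorentzE normal_direction_space normal_direction_time space_frame.
  rewrite mulmxKV ?space_frame_unit// mul1r => /eqP; rewrite subr_eq0 => /eqP <-.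
  by rewrite -dotZl -dotBl -/z => ->; rewrite ltxx.
apply/rowP => j; rewrite !mxE; case: unliftP => [k ->|->] /=; last by rewrite mulr1.
by have /rowP/(_ k) := z0; rewrite !mxE => /eqP; rewrite subr_eq0 => /eqP.
Qed.

Lemma frame_normal_unique N : (forall w, lorentz N (w *m J) = 0) ->
  lorentz N N = -1 -> 0 < N 0 ord_max -> N = frame_normal.
Proof.
move=> /orthogonal_frame_colinear NE NN N0; rewrite [LHS]NE /frame_normal.
move: NN; rewrite {1 2}NE lorentzZl lorentzZr mulrA -expr2 => NN.
congr (_ *: _); set l := lorentz _ _ in NN *.
have -> : - l = ((N 0 ord_max)^-1) ^+ 2.
  rewrite exprVn -[RHS]mulr1 -[in RHS](opprK 1) -NN mulrN mulKf//.
  rewrite expf_neq0//; exact: lt0r_neq0 N0.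
by rewrite sqrtr_sqr gtr0_norm ?invr_gt0// invrK.
Qed.

Lemma frame_normalP : [/\ forall w, lorentz frame_normal (w *m J) = 0,
  lorentz frame_normal frame_normal = -1 & 0 < frame_normal 0 ord_max].
Proof.
have l0 : 0 < - lorentz normal_direction normal_direction.
  by rewrite oppr_gt0 normal_direction_timelike.
split=> [w||].
- by rewrite lorentzZl normal_direction_orthogonal mulr0.
- rewrite lorentzZl lorentzZr mulrA -invfM -expr2 sqr_sqrtr ?ltW//.
  by rewrite -[X in _ * X]opprK mulrN mulVf// gt_eqF.
- by rewrite mxE normal_direction_time mulr1 invr_gt0 sqrtr_gt0.
Qed.

End NormalOfFrame.

Lemma unit_normalE (R : realType) n (X : 'rV[R]_n -> 'rV[R]_n.+1) u J :
  (forall w, 'D_w X u = w *m J) ->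
  (forall w, w != 0 -> 0 < lorentz ('D_w X u) ('D_w X u)) ->
  unit_normal X u = frame_normal J.
Proof.
move=> XJ Xs; have Js w : w != 0 -> 0 < lorentz (w *m J) (w *m J).
  by move=> /Xs; rewrite XJ.
have [N1 N2 N3] := frame_normalP Js.
apply: xget_unique => [|N [NX NN N0]]; first by split=> // w; rewrite XJ.
by apply: frame_normal_unique => // w; rewrite -XJ.
Qed.

(** * Differentiability of the normal *)

Section Differentiability.
Context {R : realType} {V : normedModType R}.

Lemma differentiable_bigsum (I : Type) (r : seq I) (P : pred I) (f : I -> V -> R) x :
  (forall i, differentiable (f i) x) ->
  differentiable (fun y => \sum_(i <- r | P i) f i y) x.
Proof.
move=> df; elim: r => [|i r IH].
  under eq_fun do rewrite big_nil; exact: differentiable_cst.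
under eq_fun do rewrite big_cons; case: (P i) => //.
exact: differentiableD.
Qed.

Lemma differentiable_bigprod (I : Type) (r : seq I) (P : pred I) (f : I -> V -> R) x :
  (forall i, differentiable (f i) x) ->
  differentiable (fun y => \prod_(i <- r | P i) f i y) x.
Proof.
move=> df; elim: r => [|i r IH].
  under eq_fun do rewrite big_nil; exact: differentiable_cst.
under eq_fun do rewrite big_cons; case: (P i) => //.
exact: differentiableM.
Qed.

Lemma differentiable_dot d (f g : V -> 'rV[R]_d) x :
  (forall i, differentiable (fun y => f y 0 i) x) ->
  (forall i, differentiable (fun y => g y 0 i) x) ->
  differentiable (fun y => dot (f y) (g y)) x.
Proof.
by move=> df dg; apply: differentiable_bigsum => i; exact: differentiableM.
Qed.

Lemma differentiable_det k (A : V -> 'M[R]_k) x :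
  (forall i j, differentiable (fun y => A y i j) x) ->
  differentiable (fun y => \det (A y)) x.
Proof.
move=> dA; apply: differentiable_bigsum => s; apply: differentiableM.
  exact: differentiable_cst.
exact: differentiable_bigprod.
Qed.

Lemma differentiable_sqrt (f : V -> R) x : differentiable f x -> 0 < f x ->
  differentiable (fun y => Num.sqrt (f y)) x.
Proof.
move=> df fx; apply: (differentiable_comp df).
by apply/derivable1_diffP; have [] := is_derive1_sqrt fx.
Qed.

Variables (n : nat) (J : V -> 'M[R]_(n, n.+1)) (x : V).
Hypothesis dJ : forall i j, differentiable (fun y => J y i j) x.
Hypothesis spaceJ :
  forall w : 'rV[R]_n, w != 0 -> 0 < lorentz (w *m J x) (w *m J x).

Lemma differentiable_normal_direction j :
  differentiable (fun y => normal_direction (J y) 0 j) x.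
Proof.
under eq_fun do rewrite mxE; case: unliftP => [k _|_] /=; last first.
  exact: differentiable_cst.
under eq_fun do rewrite /normal_slope 3!mxE.
apply: differentiableM.
  apply: differentiableV; last by rewrite -unitfE -unitmxE space_frame_unit.
  by apply: differentiable_det => i l; under eq_fun do rewrite mxE; exact: dJ.
apply: differentiable_bigsum => i; apply: differentiableM; last first.
  by under eq_fun do rewrite mxE; exact: dJ.
under eq_fun do rewrite mxE.
apply: differentiableM; first exact: differentiable_cst.
by apply: differentiable_det => a b; under eq_fun do rewrite !mxE; exact: dJ.
Qed.

Lemma differentiable_frame_normal j :
  differentiable (fun y => frame_normal (J y) 0 j) x.
Proof.
under eq_fun do rewrite mxE.
have l0 := normal_direction_timelike spaceJ.
apply: differentiableM; last exact: differentiable_normal_direction.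
apply: differentiableV; last by rewrite gt_eqF// sqrtr_gt0 oppr_gt0.
apply: differentiable_sqrt; last by rewrite oppr_gt0.
apply: differentiableN; under eq_fun do rewrite lorentzE.
apply: differentiableB;
  last by apply: differentiableM; exact: differentiable_normal_direction.
by apply: differentiable_dot => k; under eq_fun do rewrite mxE;
  exact: differentiable_normal_direction.
Qed.

End Differentiability.

(** * Derivatives in a direction *)

Section Derivatives.
Context {R : realType} {V : normedModType R}.

Lemma is_derive_line (W : normedModType R) (g : V -> W) (u w : V) (t : R) :
  derivable g (t *: w + u) w ->
  is_derive t 1 (fun s : R => g (s *: w + u)) ('D_w g (t *: w + u)).
Proof.
have E : (fun h : R => h^-1 *: (((fun s : R => g (s *: w + u)) \o shift t) (h *: 1)
      - g (t *: w + u))) =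
    (fun h : R => h^-1 *: ((g \o shift (t *: w + u)) (h *: w) - g (t *: w + u))).
  by apply/funext => h; rewrite /= [h *: 1]mulr1 scalerDl addrA.
by move=> dg; split; rewrite /derivable /derive E.
Qed.

(** If the second derivative were positive, the first one, which vanishes at [u],
    would be positive right after it, and [g] would increase along the line. *)
Lemma second_order_max (g : V -> R) (u w : V) :
  (\forall x \near u, derivable g x w) -> derivable ('D_w g) u w ->
  (\forall x \near u, g x <= g u) ->
  'D_w g u = 0 /\ 'D_w ('D_w g) u <= 0.
Proof.
move=> dg ddg gmax.
pose phi (t : R) := g (t *: w + u).
have [r r0 rP] : exists2 r : R, 0 < r & forall t : R, `|t| < r ->
    derivable g (t *: w + u) w /\ phi t <= phi 0.
  have nP : nbhs u [set x | derivable g x w /\ g x <= g u] by exact: filterI dg gmax.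
  have /nbhs_normP[r r0 rP] := cvg_line w nP.
  exists r => // t tr; have [|? ?] := rP t; first by rewrite /= sub0r normrN.
  by rewrite /phi scale0r add0r.
have dphi (t : R) : `|t| < r -> is_derive t 1 phi ('D_w g (t *: w + u)).
  by move=> /rP[+ _]; exact: is_derive_line.
have inr (t : R) : t \in `](- r), r[%R -> `|t| < r by rewrite in_itv/= ltr_norml.
have Dg0 : 'D_w g u = 0.
  have D0 : is_derive (0 : R) 1 phi 0.
    apply: (@derive1_at_max _ phi (- r) r) => [||| t /inr/rP[]//].
    - by rewrite ge0_cp// ltW.
    - by move=> t /inr/dphi[].
    - by rewrite in_itv/= oppr_lt0 r0.
  have := dphi 0; rewrite normr0 scale0r add0r => /(_ r0) [_ <-].
  by case: D0.
split=> //; rewrite leNgt; apply/negP => s0.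
have : \forall h \near 0^', 0 < h^-1 * ('D_w g (h *: w + u) - 'D_w g u).
  have cvDg : (fun h : R => h^-1 *: (('D_w g \o shift u) (h *: w) - 'D_w g u)) @ 0^'
     --> 'D_w ('D_w g) u by exact: ddg.
  exact: (cvgr_gt _ cvDg _ s0).
rewrite Dg0 => -[/= d d0 dP].
pose t := Num.min r d / 2.
have m0 : 0 < Num.min r d by rewrite lt_min r0.
have t0 : 0 < t by rewrite divr_gt0.
have tm : t < Num.min r d by rewrite ltr_pdivrMr// ltr_pMr// ltr1n.
have [tr td] : t < r /\ t < d by move: tm; rewrite lt_min => /andP.
have [||c] := @MVT _ phi (fun s : R => 'D_w g (s *: w + u)) 0 t t0.
- move=> s; rewrite in_itv/= => /andP[s1 s2].
  by apply: dphi; rewrite gtr0_norm// (lt_trans s2).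
- apply: derivable_within_continuous => s; rewrite in_itv/= => /andP[s1 s2].
  have sr : `|s| < r by rewrite ger0_norm// (le_lt_trans s2).
  by have [] := dphi s sr.
rewrite in_itv/= subr0 => /andP[c0 ct] phiE.
have := dP c; rewrite /ball_/= sub0r normrN gtr0_norm// (lt_trans ct td) => /(_ isT).
rewrite gt_eqF// => /(_ isT); rewrite subr0 pmulr_rgt0 ?invr_gt0// => Dc.
have tnr : `|t| < r by rewrite gtr0_norm.
have [_] := rP t tnr.
by rewrite -subr_le0 phiE leNgt mulr_gt0.
Qed.

(** The product rule for diagonal bilinear forms, which covers both the Euclidean
    and the Lorentz products. *)
Lemma is_derive_weighted_sum d (c : 'I_d -> R) (F G : V -> 'rV[R]_d) u w :
  derivable F u w -> derivable G u w ->
  is_derive u w (fun x => \sum_i c i * (F x 0 i * G x 0 i))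
    (\sum_i c i * ('D_w F u 0 i * G u 0 i) + \sum_i c i * (F u 0 i * 'D_w G u 0 i)).
Proof.
move=> dF dG.
have dFi i := (derivable_mxP _ _ _).1 dF 0 i.
have dGi i := (derivable_mxP _ _ _).1 dG 0 i.
rewrite (_ : (fun x => _) = \sum_i (fun x => c i * (F x 0 i * G x 0 i))); last first.
  by rewrite fct_sumE.
rewrite -big_split/=; apply: is_derive_sum => i.
have dM := @is_deriveZ _ _ _ _ (c i) u w _
  (@is_deriveM _ _ _ _ u w _ _ (derivableP (dFi i)) (derivableP (dGi i))).
apply: (is_derive_eq dM).
rewrite (derive_mx dF) (derive_mx dG) 2!mxE [LHS]mulrDr addrC.
by congr (_ + _ * _); rewrite [LHS]mulrC.
Qed.

Lemma is_derive_dot d (F G : V -> 'rV[R]_d) u w :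
  derivable F u w -> derivable G u w ->
  is_derive u w (fun x => dot (F x) (G x))
    (dot ('D_w F u) (G u) + dot (F u) ('D_w G u)).
Proof.
move=> dF dG; have := is_derive_weighted_sum (fun=> 1) dF dG.
have dot1 (x y : 'rV[R]_d) : dot x y = \sum_i 1 * (x 0 i * y 0 i).
  by apply: eq_bigr => i _; rewrite mul1r.
by rewrite !dot1; under [in X in _ -> X]eq_fun do rewrite dot1.
Qed.

Lemma is_derive_lorentz n (F G : V -> 'rV[R]_n.+1) u w :
  derivable F u w -> derivable G u w ->
  is_derive u w (fun x => lorentz (F x) (G x))
    (lorentz ('D_w F u) (G u) + lorentz (F u) ('D_w G u)).
Proof.
move=> dF dG.
have := is_derive_weighted_sum (fun i => (-1) ^+ (i == ord_max)) dF dG.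
by rewrite -!lorentz_sumE; under [in X in X -> _]eq_fun do rewrite -lorentz_sumE.
Qed.

End Derivatives.

(** * Curvature where a quadratic function is maximal *)

Section FarthestPoint.
Context {R : realType} {n : nat} {M : topologicalType}.
Variable psi : M -> 'rV[R]_n.+1.
Implicit Types X : 'rV[R]_n -> 'rV[R]_n.+1.

Definition frame X (x : 'rV[R]_n) : 'M[R]_(n, n.+1) :=
  \matrix_(i, j) 'D_(delta_mx 0 i) X x 0 j.

Lemma derive_frame X x w : differentiable X x -> 'D_w X x = w *m frame X x.
Proof.
move=> dX; rewrite deriveEjacobian//; congr (_ *m _); apply/matrixP => i j.
by rewrite !mxE deriveE.
Qed.

(** Off the wall the chart is a spacelike immersion all around [u], so the
    closed formula for the unit normal holds in a neighbourhood of [u]; this is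
    what makes the derivative in the shape operator meaningful. *)
Lemma derivable_unit_normal U phi X u w : spacelike psi ->
  local_param psi U phi X -> (U `&` half_space R n) u -> ~ wall R n u ->
  (\forall x \near u, forall w', lorentz (unit_normal X x) ('D_w' X x) = 0) /\
  derivable (unit_normal X) u w.
Proof.
move=> spsi LX [Uu Hu] nw.
have oU := local_param_open LX.
have dX x : U x -> differentiable X x by exact: local_param_diff LX.
have nU : \forall x \near u, (U `&` half_space R n) x.
  by apply: filterS2 (near_interior Hu nw) (open_nbhs_nbhs (conj oU Uu)) => x [].
have DXE x w' : U x -> 'D_w' X x = w' *m frame X x.
  by move=> Ux; exact: derive_frame (dX x Ux).
have space x w' : (U `&` half_space R n) x -> w' != 0 ->
    0 < lorentz ('D_w' X x) ('D_w' X x).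
  by move=> Ux; apply: (spsi (phi x)); exists U, phi.
have NE x : (U `&` half_space R n) x -> unit_normal X x = frame_normal (frame X x).
  by move=> Ux; apply: unit_normalE => w'; [exact: DXE Ux.1|exact: space].
have spaceJ x : (U `&` half_space R n) x -> forall w', w' != 0 ->
    0 < lorentz (w' *m frame X x) (w' *m frame X x).
  by move=> Ux w' w'0; rewrite -DXE ?space//; case: Ux.
split.
  apply: filterS nU => x Ux w'; rewrite NE// DXE; last by case: Ux.
  by have [] := frame_normalP (spaceJ x Ux).
have /near_eq_derivable : \forall x \near u, frame_normal (frame X x) = unit_normal X x.
  by apply: filterS nU => x /NE.
apply; apply/derivable_mxP => i j; rewrite ord1; apply: diff_derivable.
apply: differentiable_frame_normal; last exact: spaceJ.
move=> k l; under eq_fun do rewrite mxE.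
have [_ /(_ (delta_mx 0 k))[dDX _]] := local_param_smooth LX 2.
exact: (differentiable_comp (dDX u Uu) (@differentiable_coord _ _ _ _ 0 l)).
Qed.

Variables (a : 'rV[R]_n.+1) (e : R).
Hypothesis e0 : 0 < e.

Let f (y : 'rV[R]_n.+1) := dot a y + e * dot y y.
Let eta (y : 'rV[R]_n.+1) := a + (2 * e) *: y.

(** The gradient [eta] at [p] does not involve the chart, so the sign obtained
    here is common to all the principal curvatures at [p]. *)
Lemma principal_curvature_at_max p k : spacelike psi -> ~ boundary psi p ->
  (forall q, f (psi q) <= f (psi p)) -> principal_curvature psi p k ->
  0 < eta (psi p) 0 ord_max * k.
Proof.
move=> spsi pB fmax [X [u [pX [w w0 shapeE]]]].
have nw : ~ wall R n u by move=> uw; apply: pB; exists X, u.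
have [U [phi [LX Uu pu]]] := pX; have oU := local_param_open LX.
have nUH : \forall x \near u, (U `&` half_space R n) x.
  apply: filterS2 (near_interior Uu.2 nw) (open_nbhs_nbhs (conj oU Uu.1)).
  by move=> x [].
have nU : \forall x \near u, U x by apply: filterS nUH => x [].
have dX x w' : U x -> derivable X x w'.
  by move=> Ux; exact/diff_derivable/(local_param_diff LX).
have Xu : X u = psi p by rewrite (local_paramE LX)// pu.
have Df x w' : U x -> is_derive x w' (f \o X) (dot (eta (X x)) ('D_w' X x)).
  move=> Ux; have dXx := dX x w' Ux.
  have da := is_derive_dot (derivable_cst a x w') dXx.
  have dn := is_deriveZ e (is_derive_dot dXx dXx).
  apply: (is_derive_eq (is_deriveD da dn)).
  rewrite derive_cst /eta dotDl dotZl (dotC ('D_w' X x)) -(scale0r a) dotZl mul0r.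
  by rewrite /GRing.scale/=; ring.
have gmax : \forall x \near u, (f \o X) x <= (f \o X) u.
  by apply: filterS nUH => x Ux; rewrite /= Xu (local_paramE LX) ?fmax.
have near_dg w' : \forall x \near u, derivable (f \o X) x w'.
  by apply: filterS nU => x Ux; have [] := Df x w' Ux.
have near_Dg w' : \forall x \near u,
    dot (eta (X x)) ('D_w' X x) = 'D_w' (f \o X) x.
  by apply: filterS nU => x Ux; have [_ ->] := Df x w' Ux.
have order2 w' : dot (eta (psi p)) ('D_w' X u) = 0 /\
    dot ((2 * e) *: 'D_w' X u) ('D_w' X u) +
    dot (eta (psi p)) ('D_w' ('D_w' X) u) <= 0.
  have dDX : derivable ('D_w' X) u w'.
    have [_ /(_ w')[dDX _]] := local_param_smooth LX 2.
    exact/diff_derivable/dDX/Uu.1.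
  have deta : is_derive u w' (fun x => eta (X x)) ((2 * e) *: 'D_w' X u).
    have := is_deriveD (is_derive_cst a u w')
      (is_deriveZ (2 * e) (derivableP (dX u w' Uu.1))).
    by rewrite add0r.
  have [etaXd etaXE] := deta.
  have [D2d D2E] := is_derive_dot etaXd dDX.
  have [] := second_order_max (near_dg w') (near_eq_derivable (near_Dg w') D2d) gmax.
  rewrite -(near_eq_derive _ (near_Dg w')) D2E etaXE.
  by rewrite -(nbhs_singleton (near_Dg w')) Xu.
have DX_gt0 w' : w' != 0 -> 0 < lorentz ('D_w' X u) ('D_w' X u).
  by move=> w'0; exact: spsi pX _ w'0.
have concave : dot (eta (psi p)) ('D_w ('D_w X) u) < 0.
  have DX0 : 'D_w X u != 0.
    apply/eqP => DX0; have := DX_gt0 w w0.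
    by rewrite DX0 lorentz_sumE big1 ?ltxx// => i _; rewrite mxE mul0r mulr0.
  have [_] := order2 w; rewrite dotZl -lerBrDl sub0r => /le_lt_trans; apply.
  by rewrite oppr_lt0 !mulr_gt0// dot_gt0.
have JE w' : 'D_w' X u = w' *m frame X u.
  by apply: derive_frame; exact: local_param_diff LX Uu.1.
have spaceJ w' : w' != 0 -> 0 < lorentz (w' *m frame X u) (w' *m frame X u).
  by move=> w'0; rewrite -JE DX_gt0.
set m := normal_direction (frame X u).
have [N_orth N_der] := derivable_unit_normal w spsi LX Uu nw.
have NE : unit_normal X u = unit_normal X u 0 ord_max *: m.
  apply: orthogonal_frame_colinear => // w'; rewrite -JE.
  exact: (nbhs_singleton N_orth).
have N_pos : 0 < unit_normal X u 0 ord_max.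
  by rewrite (unit_normalE JE DX_gt0); have [] := frame_normalP spaceJ.
(* eta is normal in the Euclidean sense; flipped, it is a multiple of m *)
have etaE (y : 'rV[R]_n.+1) :
    dot (eta (psi p)) y = - eta (psi p) 0 ord_max * lorentz m y.
  set fl := \row_j ((-1) ^+ (j == ord_max) * eta (psi p) 0 j).
  have flE : fl = fl 0 ord_max *: m.
    apply: orthogonal_frame_colinear => // w'; rewrite -JE lorentz_flip.
    by have [] := order2 w'.
  rewrite -lorentz_flip -/fl flE lorentzZl; congr (_ * _).
  by rewrite mxE eqxx expr1 mulN1r.
(* differentiate <N, D_w X>_L = 0 *)
have weingarten : lorentz ('D_w (unit_normal X) u) ('D_w X u) +
    lorentz (unit_normal X u) ('D_w ('D_w X) u) = 0.
  have dDX : derivable ('D_w X) u w.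
    have [_ /(_ w)[dDX _]] := local_param_smooth LX 2.
    exact/diff_derivable/dDX/Uu.1.
  have [_ <-] := is_derive_lorentz N_der dDX.
  have /near_eq_derive -> : \forall x \near u,
      lorentz (unit_normal X x) ('D_w X x) = 0.
    by apply: filterS N_orth => x.
  exact: derive_cst.
have curvE : k * lorentz ('D_w X u) ('D_w X u) =
    unit_normal X u 0 ord_max * lorentz m ('D_w ('D_w X) u).
  rewrite -lorentzZl -shapeE lorentzNl -lorentzZl -NE.
  by apply/eqP; rewrite eqr_oppLR -addr_eq0 weingarten.
move: concave; rewrite etaE mulNr oppr_lt0 => concave.
rewrite -(pmulr_lgt0 _ (DX_gt0 w w0)) -mulrA curvE mulrCA.
exact: mulr_gt0.
Qed.

End FarthestPoint.

Theorem theorem3 (R : realType) (n : nat) (M : topologicalType)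
    (psi : M -> 'rV[R]_n.+1) :
  hypersurface psi -> spacelike psi -> compact [set: M] ->
  boundary psi !=set0 ->
  ~ (range psi `<=` convex_hull (psi @` boundary psi)) ->
  exists p : M, elliptic psi p.
Proof.
move=> hpsi spsi cM [b0 Bb0] nhull.
have [p0 qhull] : exists p0, ~ convex_hull (psi @` boundary psi) (psi p0).
  apply: contrapT => H; apply: nhull => _ [p0 _ <-].
  by apply: contrapT => Hp; apply: H; exists p0.
have cpsi := continuous_hypersurface hpsi.
have cB : compact (psi @` boundary psi).
  apply: continuous_compact; first exact: continuous_subspaceT.
  exact: subclosed_compact (closed_boundary hpsi) cM _.
have B0 : (psi @` boundary psi) !=set0 by exists (psi b0), b0.
have [a [e e0 ae]] := exists_quadratic_separation cB B0 qhull.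
pose f y := dot a y + e * dot y y.
have cf : {within [set: M], continuous (f \o psi)}.
  apply: continuous_subspaceT => p; have cp : {for p, continuous psi} := cpsi p.
  have ca : {for p, continuous (fun _ : M => a)} by exact: cvg_cst.
  exact: (cvgD (continuous_dotP ca cp) (cvgM (cvg_cst e) (continuous_dotP cp cp))).
have [p _ pmax] := compact_EVT_max (ex_intro _ b0 I) cM cf.
have fmax q : f (psi q) <= f (psi p) by apply: pmax; rewrite inE.
have pB : ~ boundary psi p.
  move=> Bp; have := ae _ (ex_intro2 _ _ p Bp erefl).
  by rewrite ltNge fmax.
have curv k := principal_curvature_at_max e0 spsi pB fmax (k := k).
(* all curvatures at p have the sign of the time component of the gradient *)
exists p; have [eta0|eta0] := ltP 0 ((a + (2 * e) *: psi p) 0 ord_max).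
  by left => k /curv; rewrite pmulr_rgt0.
right => k /curv kpos; rewrite ltNge; apply/negP => k0.
by move: kpos; rewrite ltNge mulr_le0_ge0.
Qed.
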